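(* Let $k\ge 2$, let $\mathcal{P}_1,\dots,\mathcal{P}_k\subseteq\mathbb{R}^n$ be polytopes, each with at least two vertices, and let $\mathcal{P} := \prod_{i=1}^k \mathcal{P}_i$ be their Cartesian product. Then $$\delta_{\mathcal{P}} \ \ge\ \frac{1}{(\sqrt{2})^{\lceil \log_2(k+1)\rceil}}\ \min_{1\le i\le k}\delta_{\mathcal{P}_i},$$ and the right-hand side is $\Omega\big(\tfrac{1}{\sqrt{k}}\min_{1\le i\le k}\delta_{\mathcal{P}_i}\big)$, i.e. it is at least $\tfrac{c}{\sqrt{k}}\min_{1\le i\le k}\delta_{\mathcal{P}_i}$ for an absolute constant $c>0$.
   Context: A polytope is the convex hull of a finite set of points. For a polytope $\mathcal{P}$, $\mathcal{V}_{\mathcal{P}}$ is its set of vertices, and a face of $\mathcal{P}$ is proper if it is neither $\emptyset$ nor $\mathcal{P}$ itself; $\mathsf{faces}^*(\mathcal{P})$ is the set of proper faces. $\|\cdot\|$ is the Euclidean norm, and $\mathsf{dist}(A,B)$ is the minimum of $\|x-y\|$ over $x\in A$, $y\in B$. For a polytope $\mathcal{P}$ with at least two vertices, the pyramidal width is $$\delta_{\mathcal{P}} := \min_{f\in\mathsf{faces}^*(\mathcal{P})} \mathsf{dist}\big(f,\ \mathrm{conv}(\mathcal{V}_{\mathcal{P}}\setminus f)\big).$$ *)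

(* Defs.v *)
From mathcomp Require Import all_boot all_order all_algebra.
From mathcomp Require Import boolp classical_sets functions cardinality reals convex.
Set Implicit Arguments.
Unset Strict Implicit.
Unset Printing Implicit Defensive.
Import Order.TTheory GRing.Theory Num.Theory.

Local Open Scope classical_set_scope.
Local Open Scope ring_scope.

Section Polytopes.
Variables (R : realType) (n : nat).
Implicit Types (A B P f : set 'rV[R]_n) (x y c : 'rV[R]_n).

Definition dotv x y : R := \sum_j x 0 j * y 0 j.

(* The norm `|x| that MathComp puts on matrices is the sup norm. *)
Definition enorm x : R := Num.sqrt (\sum_j x 0 j ^+ 2).

Definition conv A : set 'rV[R]_n := smallest (@convex_set R 'rV[R]_n) A.

Definition polytope P := exists2 A, finite_set A & P = conv A.

(* Faces are cut out by valid inequalities <c, x> <= b; taking c = 0 and b = 0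
   (resp. b = 1) yields P (resp. the empty set) as an improper face. *)
Definition face P f := exists c b,
  (forall x, P x -> dotv c x <= b) /\ f = P `&` [set x | dotv c x = b].

Definition proper_face P f := [/\ face P f, f <> set0 & f <> P].

(* The vertices are the zero-dimensional faces. *)
Definition vertices P : set 'rV[R]_n := [set v | face P [set v]].

Definition at_least_two_vertices P :=
  exists u v, [/\ vertices P u, vertices P v & u <> v].

(* The infimum is a minimum for nonempty compact A and B, which is the case for
   the sets compared in pyramidal_width below. *)
Definition dist A B : R :=
  inf [set d | exists x y, [/\ A x, B y & d = enorm (x - y)]].

(* A polytope has finitely many faces, and a proper one if it has at least two
   vertices, so that the infimum is again a minimum. *)
Definition pyramidal_width P : R :=
  inf [set dist f (conv (vertices P `\` f)) | f in proper_face P].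

End Polytopes.

(* The space (R^n)^k is identified with R^(k * n) through the row-major
   enumeration vec_mx of the entries of a k x n matrix. *)
Definition cart_prod (R : realType) (n k : nat) (P : 'I_k -> set 'rV[R]_n) :
    set 'rV[R]_(k * n) :=
  [set x | forall i, P i (row i (vec_mx x))].

(* Main.v *)
From Pilot Require Import Defs.
From mathcomp Require Import all_boot all_order all_algebra.
From mathcomp Require Import boolp classical_sets functions cardinality reals convex.
From mathcomp Require Import interval_inference.
From mathcomp Require Import lra ring zify.
Set Implicit Arguments.
Unset Strict Implicit.
Unset Printing Implicit Defensive.
Import Order.TTheory GRing.Theory Num.Theory.
Local Open Scope classical_set_scope.
Local Open Scope ring_scope.

(** The heart of the matter concerns a single polytope P with vertex set V and
pyramidal width delta. If x lies in a face f and y = sum_v rho_v v is a convex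
combination of vertices, then |x - y| >= delta * rho(V \ f), however large the
part of rho carried by f may be ([off_face_mass_le]). For rho(f) = 0 this is the
definition of delta. Otherwise pick v in f with rho_v > 0, write x as a
combination of the vertices of f too, and subtract from both x and y as much of
v as possible. The difference x - y and the mass rho(V \ f) do not change.
Either rho_v becomes 0, or what is left of x cannot give up any more v; by
Farkas' lemma ([farkas], [cone_boundary]) it then lies in the cone over a face
of f that avoids v. Both cases make progress, so the process ends with rho
vanishing on the current face. The two remainders have a common mass t, which is
at least the original rho(V \ f), and the definition of delta bounds their
distance below by t * delta.

A face of the product is a product of faces f_i of the factors, and its vertices
are the tuples of vertices. If y is a convex combination of vertices of the
product outside f = prod_i f_i, every such vertex has a component outside the
corresponding f_i, so the masses mu_i that the marginals of the combination put
outside f_i satisfy sum_i mu_i >= 1. With d the least width of the factors,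
|x - y|^2 = sum_i |x_i - y_i|^2 >= d^2 sum_i mu_i^2 >= d^2 / k
([cart_prod_face_gap]). Thus the width of the product is at least d / sqrt k
([pyramidal_width_cart_prod_ge]), and the stated bounds follow from
k <= 2 ^ ceil(log2(k + 1)) <= 4 k. *)

(** * The inner product and Farkas' lemma *)

Section Dot.
Variables (R : realType) (n : nat).
Implicit Types (c x y : 'rV[R]_n).

Lemma dotvC x y : dotv x y = dotv y x.
Proof. by apply: eq_bigr => j _; rewrite mulrC. Qed.

Lemma dotvDr c x y : dotv c (x + y) = dotv c x + dotv c y.
Proof. by rewrite -big_split; apply: eq_bigr => j _; rewrite mxE mulrDr. Qed.

Lemma dotvZr c (a : R) x : dotv c (a *: x) = a * dotv c x.
Proof. by rewrite mulr_sumr; apply: eq_bigr => j _; rewrite mxE mulrCA. Qed.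

Lemma dotvNr c x : dotv c (- x) = - dotv c x.
Proof. by rewrite -scaleN1r dotvZr mulN1r. Qed.

Lemma dotvBr c x y : dotv c (x - y) = dotv c x - dotv c y.
Proof. by rewrite dotvDr dotvNr. Qed.

Lemma dotvDl c x y : dotv (x + y) c = dotv x c + dotv y c.
Proof. by rewrite !(dotvC _ c) dotvDr. Qed.

Lemma dotvZl c (a : R) x : dotv (a *: x) c = a * dotv x c.
Proof. by rewrite !(dotvC _ c) dotvZr. Qed.

Lemma dotvNl c x : dotv (- x) c = - dotv x c.
Proof. by rewrite !(dotvC _ c) dotvNr. Qed.

Lemma dotv_sumr (T : Type) c (s : seq T) (w : T -> R) (a : T -> 'rV[R]_n) :
  dotv c (\sum_(t <- s) w t *: a t) = \sum_(t <- s) w t * dotv c (a t).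
Proof.
elim: s => [|t s IH]; first by rewrite !big_nil -(scale0r 0) dotvZr mul0r.
by rewrite !big_cons dotvDr dotvZr IH.
Qed.

Lemma dotvv_gt0 x : x != 0 -> 0 < dotv x x.
Proof.
move=> x0; rewrite lt_neqAle sumr_ge0 ?andbT; last by move=> j _; rewrite -expr2 sqr_ge0.
apply: contra x0; rewrite eq_sym psumr_eq0; last by move=> j _; rewrite -expr2 sqr_ge0.
move/allP => h; apply/eqP/rowP => j; rewrite mxE.
by have := h j (mem_index_enum _); rewrite mulf_eq0 orbb => /eqP.
Qed.

Lemma enormZ (a : R) x : 0 <= a -> enorm (a *: x) = a * enorm x.
Proof.
move=> a0; rewrite /enorm (_ : \sum_j _ = a ^+ 2 * \sum_j x 0 j ^+ 2).
  by rewrite sqrtrM ?sqr_ge0// sqrtr_sqr ger0_norm.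
by rewrite mulr_sumr; apply: eq_bigr => j _; rewrite mxE exprMn.
Qed.

Lemma enorm_ge0 x : 0 <= enorm x.
Proof. exact: sqrtr_ge0. Qed.

End Dot.

Section Farkas.
Variable R : realType.

(** Induction on the generators: if c separates x from all but the generator t,
then project along t onto the hyperplane c = 0. The other generators get
there by adding nonnegative multiples of t, so a conic combination for the
projection of x lifts to one for x, and a separating functional for the projected
data, composed with the projection, vanishes at t and separates the original. *)
Lemma farkas (T : eqType) n (s : seq T) (a : T -> 'rV[R]_n) (x : 'rV[R]_n) :
  uniq s ->
  (exists2 w : T -> R, forall t, 0 <= w t & x = \sum_(t <- s) w t *: a t) \/
  (exists2 c, {in s, forall t, 0 <= dotv c (a t)} & dotv c x < 0).
Proof.
elim: s a x => [|t s IH] a x.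
  move=> _; have [->|x0] := eqVneq x 0.
    by left; exists (fun=> 0) => //; rewrite big_nil.
  by right; exists (- x) => //; rewrite dotvNl oppr_lt0 dotvv_gt0.
move=> /= /andP[ts us].
have cons_w (l : R) (w : T -> R) : \sum_(u <- s) (if u == t then l else w u) *: a u
    = \sum_(u <- s) w u *: a u.
  by apply: eq_big_seq => u us'; case: eqP => // ut; rewrite -ut us' in ts.
have [[w w0 ->]|[c c0 cx]] := IH a x us.
  left; exists (fun u => if u == t then 0 else w u).
    by move=> u; case: eqP.
  by rewrite big_cons eqxx scale0r add0r cons_w.
have [ct|ct] := leP 0 (dotv c (a t)).
  by right; exists c => // u; rewrite inE => /predU1P[->//|]; exact: c0.
(* y + q y *: a t is the projection of y; q is nonnegative on the generators in s *)
pose q y : R := - (dotv c y / dotv c (a t)).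
have [[w w0 xE]|[d d0 dx]] := IH (fun u => a u + q (a u) *: a t) (x + q x *: a t) us.
  left; exists (fun u => if u == t then \sum_(v <- s) w v * q (a v) - q x else w u).
    move=> u; case: eqP => // _; rewrite subr_ge0 (@le_trans _ _ 0)//.
      by rewrite oppr_le0 ltW// ltr_ndivlMr ?mul0r// -subr_gt0 subr0 -?oppr_lt0.
    rewrite big_seq sumr_ge0// => v vs; rewrite mulr_ge0// oppr_ge0.
    by rewrite ler_ndivrMr ?mul0r// c0.
  rewrite big_cons eqxx cons_w scalerBl addrAC; apply/eqP; rewrite eq_sym subr_eq xE.
  rewrite scaler_suml -big_split; apply/eqP/eq_bigr => v _ /=.
  by rewrite scalerDr scalerA addrC.
right; exists (d + - (dotv d (a t) / dotv c (a t)) *: c).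
  move=> u; rewrite inE => /predU1P[->|/d0].
    by rewrite dotvDl dotvZl mulNr divfK ?subrr// lt_eqF.
  by rewrite dotvDr dotvZr dotvDl dotvZl /q; congr (_ <= _ + _); ring.
by move: dx; rewrite dotvDr dotvZr dotvDl dotvZl /q; congr (_ + _ < _); ring.
Qed.

Lemma dotv_row_mx n (h g : R) (c x : 'rV[R]_n) :
  dotv (row_mx (const_mx h) c : 'rV_(1 + n)) (row_mx (const_mx g) x)
  = h * g + dotv c x.
Proof.
rewrite {1}/dotv big_split_ord big_ord1 !row_mxEl !mxE; congr (_ + _).
by apply: eq_bigr => j _; rewrite !row_mxEr.
Qed.

(** Farkas' lemma for the vectors (h t, a t) of R^(1 + n); with h = 1 the
functionals on R^(1 + n) are the affine functionals on the points a t. *)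
Lemma farkas_affine (T : eqType) n (s : seq T) (h : T -> R) (a : T -> 'rV[R]_n)
    (m : R) (x : 'rV[R]_n) : uniq s ->
  (exists w : T -> R, [/\ forall t, 0 <= w t, m = \sum_(t <- s) w t * h t
     & x = \sum_(t <- s) w t *: a t]) \/
  (exists c (b : R), {in s, forall t, dotv c (a t) <= b * h t} /\ b * m < dotv c x).
Proof.
move=> us.
pose lift g (y : 'rV[R]_n) : 'rV[R]_(1 + n) := row_mx (const_mx g) y.
have [[w w0 xE]|[c c0 cx]] := @farkas T _ s (fun t => lift (h t) (a t)) (lift m x) us.
  left; exists w; split=> //.
    have /(congr1 (fun y : 'rV[R]_(1 + n) => lsubmx y 0 0)) := xE.
    rewrite row_mxKl mxE => ->; rewrite linear_sum/= summxE; apply: eq_bigr => t _.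
    by rewrite linearZ /= row_mxKl !mxE.
  have /(congr1 (fun y : 'rV[R]_(1 + n) => rsubmx y)) := xE.
  rewrite row_mxKr => ->; rewrite linear_sum/=; apply: eq_bigr => t _.
  by rewrite linearZ /= row_mxKr.
have cE : c = lift (c 0 0) (rsubmx c).
  rewrite -[LHS](@hsubmxK _ _ 1 n); congr row_mx.
  by apply/rowP => j; rewrite ord1 !mxE; congr (c _ _); apply/val_inj.
right; exists (- rsubmx c), (c 0 0); split.
  move=> t /c0; rewrite cE dotv_row_mx -cE dotvNl; lra.
move: cx; rewrite cE dotv_row_mx -cE dotvNl; lra.
Qed.

End Farkas.

(** * Cones over finite sets of points *)

Section Cone.
Variables (R : realType) (n : nat).
Implicit Types (s V W : seq 'rV[R]_n) (c x v : 'rV[R]_n) (m b : R).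

(** The cone over s x {1} in R^(1 + n); m is the total mass of the combination.
Its slice at m = 1 is the convex hull of s. *)
Definition cone s m x := exists w : 'rV[R]_n -> R,
  [/\ forall v, 0 <= w v, m = \sum_(v <- s) w v & x = \sum_(v <- s) w v *: v].

Lemma cone_ge0 s m x : cone s m x -> 0 <= m.
Proof. by case=> w [w0 -> _]; apply: sumr_ge0. Qed.

Lemma coneD s m1 m2 x1 x2 : cone s m1 x1 -> cone s m2 x2 -> cone s (m1 + m2) (x1 + x2).
Proof.
move=> [w1 [w10 -> ->]] [w2 [w20 -> ->]]; exists (w1 \+ w2); split.
- by move=> v; rewrite addr_ge0.
- by rewrite big_split.
- by rewrite -big_split; apply: eq_bigr => v _; rewrite scalerDl.
Qed.

Lemma coneZ s (k : R) m x : 0 <= k -> cone s m x -> cone s (k * m) (k *: x).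
Proof.
move=> k0 [w [w0 -> ->]]; exists (fun v => k * w v); split.
- by move=> v; rewrite mulr_ge0.
- by rewrite mulr_sumr.
- by rewrite scaler_sumr; apply: eq_bigr => v _; rewrite scalerA.
Qed.

Lemma cone_level s m x c b : {in s, forall v, dotv c v = b} -> cone s m x ->
  dotv c x = b * m.
Proof.
move=> cb [w [_ -> ->]]; rewrite dotv_sumr mulr_sumr.
by apply: eq_big_seq => v /cb ->; rewrite mulrC.
Qed.

Lemma cone1 s v : uniq s -> v \in s -> cone s 1 v.
Proof.
move=> us vs; exists (fun u => (u == v)%:R); split.
- by move=> u; case: eqP.
- by rewrite (bigD1_seq v)//= eqxx big1 ?addr0// => u /negPf ->.
- rewrite (bigD1_seq v)//= eqxx scale1r big1 ?addr0// => u /negPf ->.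
  by rewrite scale0r.
Qed.

Lemma cone_le s m x c b : {in s, forall v, dotv c v <= b} -> cone s m x ->
  dotv c x <= b * m.
Proof.
move=> cb [w [w0 -> ->]]; rewrite dotv_sumr mulr_sumr big_seq [leRHS]big_seq.
by apply: ler_sum => v vs; rewrite mulrC ler_wpM2r// cb.
Qed.

Lemma cone_supp s m x c b : {in s, forall v, dotv c v <= b} ->
  cone s m x -> dotv c x = b * m -> cone [seq v <- s | dotv c v == b] m x.
Proof.
move=> cb [w [w0 -> ->]]; rewrite dotv_sumr mulr_sumr => /eqP.
rewrite eq_sym -subr_eq0 -sumrB big_seq psumr_eq0; last first.
  by move=> v vs; rewrite mulrC -mulrBr mulr_ge0// subr_ge0 cb.
move=> /allP wE; have w00 v : v \in s -> dotv c v != b -> w v = 0.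
  move=> vs cv; have := wE v vs; rewrite vs/= mulrC -mulrBr mulf_eq0.
  by rewrite subr_eq0 [b == _]eq_sym (negPf cv) orbF => /eqP.
exists w; split=> //; rewrite big_filter [RHS]big_mkcond;
  apply: eq_big_seq => v vs; case: ifPn => // /w00 -> //.
by rewrite scale0r.
Qed.

Lemma cone_farkas s m x : uniq s -> cone s m x \/
  exists c b, {in s, forall v, dotv c v <= b} /\ b * m < dotv c x.
Proof.
move=> us; have [[w [w0 -> ->]]|[c [b [cb cx]]]] :=
  @farkas_affine R _ n s (fun=> 1) id m x us.
  by left; exists w; split=> //; apply: eq_bigr => v _; rewrite mulr1.
by right; exists c, b; split=> // v /cb; rewrite mulr1.
Qed.

(** If no positive multiple of (1, v) can be subtracted from (m, x) within the
cone, then (-1, -v) is not in the larger cone generated by s x {1} and (-m, -x);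
Farkas' lemma yields a functional that is tight at (m, x) but not at v. *)
Lemma cone_boundary s m x v : uniq s -> cone s m x ->
  (forall e, 0 < e -> ~ cone s (m - e) (x - e *: v)) ->
  exists c b, [/\ {in s, forall u, dotv c u <= b}, dotv c v < b & dotv c x = b * m].
Proof.
move=> us sx vx; pose h (o : option 'rV[R]_n) := if o is Some _ then 1 else - m.
pose a (o : option 'rV[R]_n) := if o is Some u then u else - x.
have [|[w [w0 mE vE]]|[c [b [cb cv]]]] :=
  @farkas_affine R _ n (None :: [seq Some u | u <- s]) h a (- 1) (- v).
- rewrite /= map_inj_uniq ?us ?andbT; last by move=> ? ? [].
  by apply/mapP => -[].
- move: mE vE; rewrite !big_cons !big_map/= => mE vE.
  have wN : 0 < w None.
    rewrite lt_neqAle w0 andbT; apply/eqP => wN; move: mE; rewrite -wN mul0r add0r.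
    have : 0 <= \sum_(j <- s) w (Some j) * 1.
      by apply: sumr_ge0 => u _; rewrite mulr1.
    lra.
  case: (vx (w None)^-1); rewrite ?invr_gt0//.
  have -> : m - (w None)^-1 = (w None)^-1 * (w None * m - 1).
    by rewrite mulrBr mulr1 mulKf// gt_eqF.
  have -> : x - (w None)^-1 *: v = (w None)^-1 *: (w None *: x - v).
    by rewrite scalerBr scalerA mulVf ?scale1r// gt_eqF.
  apply: coneZ; first by rewrite invr_ge0 ltW.
  exists (fun u => w (Some u)); split=> //.
    by move: mE; under [X in _ + X]eq_bigr do rewrite mulr1; lra.
  by rewrite vE scalerN addrA subrr add0r.
exists c, b; split.
- move=> u us'; have := cb (Some u); rewrite inE map_f//= => /(_ isT).
  by rewrite mulr1.
- by move: cv; rewrite mulrN1 dotvNr ltrN2.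
- apply/eqP; rewrite eq_le (cone_le _ sx) /=; last first.
    move=> u us'; have := cb (Some u); rewrite inE map_f//= => /(_ isT).
    by rewrite mulr1.
  by have := cb None (mem_head _ _); rewrite /= dotvNr mulrN lerN2.
Qed.

(** A largest multiple exists since the cone is closed: a functional that
separated the remainder at the supremum t from the cone would also separate the
remainders for multiples close to t. *)
Lemma cone_max_removal s m x v : uniq s -> cone s m x ->
  exists t, [/\ 0 <= t, cone s (m - t) (x - t *: v) &
    forall e, 0 < e -> ~ cone s (m - t - e) (x - t *: v - e *: v)].
Proof.
move=> us sx; pose S := [set t | 0 <= t /\ cone s (m - t) (x - t *: v)].
have S0 : S 0 by split=> //; rewrite scale0r !subr0.
have supS : has_sup S.
  split; first by exists 0.
  by exists m => t [_ /cone_ge0]; rewrite subr_ge0.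
have ubS t : S t -> t <= sup S by apply: sup_upper_bound.
have [St|[c [b [cb cx]]]] := cone_farkas (m - sup S) (x - sup S *: v) us.
  exists (sup S); split=> //; first exact: ubS.
  move=> e e0; rewrite -addrA -opprD -addrA -opprD -scalerDl => Se.
  have : S (sup S + e) by split=> //; rewrite addr_ge0 ?ubS// ltW.
  by move/ubS; rewrite gerDl leNgt e0.
pose k := dotv c v - b; pose g := dotv c (x - sup S *: v) - b * (m - sup S).
have g0 : 0 < g by rewrite subr_gt0.
have k0 : 0 < `|k| + 1 by rewrite ltr_wpDl.
have [|t St] := @sup_adherent _ _ (g / (`|k| + 1)) _ supS; first by rewrite divr_gt0.
have [_ /(cone_le cb)] := St; have := ubS _ St.
rewrite ltrBlDr -ltrBlDl ltr_pdivlMr// => tS; rewrite dotvBr dotvZr => ct gt.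
have gE : g = dotv c x - sup S * dotv c v - b * (m - sup S).
  by rewrite /g dotvBr dotvZr.
have kE : k = dotv c v - b by [].
have kk : - `|k| <= k by rewrite lerNl -normrN ler_norm.
nra.
Qed.

Lemma scale_dominates (T : eqType) (s : seq T) (p q : T -> R) :
  {in s, forall t, 0 < p t} -> exists2 M : R, 0 <= M & {in s, forall t, q t < M * p t}.
Proof.
elim: s => [|t s IH] ps; first by exists 0.
have [u us|M M0 Mq] := IH; first by apply: ps; rewrite inE us orbT.
have pt : 0 < p t by apply: ps; rewrite mem_head.
exists (M + (`|q t| + 1) / p t).
  by rewrite addr_ge0// divr_ge0 ?ltW// ltr_wpDl.
move=> u; rewrite inE => /predU1P[->|us].
  rewrite mulrDl divfK ?gt_eqF// ltr_wpDl ?mulr_ge0 ?(ltW pt)//.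
  by rewrite (le_lt_trans (ler_norm _))// ltrDl.
have pu : 0 < p u by apply: ps; rewrite inE us orbT.
by rewrite mulrDl ltr_wpDr ?Mq// mulr_ge0 ?divr_ge0 ?addr_ge0 ?(ltW pt) ?(ltW pu).
Qed.

(** The vertex sets of faces; W = V and W = [::] are allowed. *)
Definition facial V W := exists c b,
  {in V, forall v, dotv c v <= b} /\ W = [seq v <- V | dotv c v == b].

(** A face of a face is a face: add to c a multiple M of the functional c0 that
cuts out W, with M so large that the points of V outside W stay below the bound. *)
Lemma facial_trans V W c b : facial V W -> {in W, forall v, dotv c v <= b} ->
  facial V [seq v <- W | dotv c v == b].
Proof.
move=> [c0 [b0 [cb0 WE]]] cb.
have [v|M M0 MP] := @scale_dominates _ [seq v <- V | dotv c0 v != b0]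
    (fun v => b0 - dotv c0 v) (fun v => dotv c v - b).
  by rewrite mem_filter => /andP[vb vV]; rewrite subr_gt0 lt_neqAle vb cb0.
have out v : v \in V -> dotv c0 v != b0 -> dotv (M *: c0 + c) v < M * b0 + b.
  move=> vV vb; have := MP v; rewrite mem_filter vb vV => /(_ isT).
  by rewrite dotvDl dotvZl; nra.
have ins v : v \in V -> dotv c0 v == b0 ->
    dotv (M *: c0 + c) v = M * b0 + b + (dotv c v - b) /\ dotv c v <= b.
  move=> vV vb; rewrite dotvDl dotvZl (eqP vb); split; first by lra.
  by apply: cb; rewrite WE mem_filter vb.
exists (M *: c0 + c), (M * b0 + b); split=> [v vV|].
  have [vb|vb] := eqVneq (dotv c0 v) b0; last by rewrite ltW ?out.
  by have [|->] := ins v vV; rewrite ?vb//; lra.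
rewrite {1}WE -filter_predI; apply: eq_in_filter => v vV /=.
have [vb|vb] := eqVneq (dotv c0 v) b0; last first.
  by rewrite andbF lt_eqF ?out.
have [|-> _] := ins v vV; rewrite ?vb//.
by rewrite andbT -[RHS]subr_eq0 addrAC subrr add0r subr_eq0.
Qed.

Lemma facial_sub V W : facial V W -> {subset W <= V}.
Proof. by move=> [c [b [_ ->]]] v; rewrite mem_filter => /andP[]. Qed.

Lemma facial_uniq V W : uniq V -> facial V W -> uniq W.
Proof. by move=> uV [c [b [_ ->]]]; rewrite filter_uniq. Qed.

(** Mass of rho inside W never helps to shorten the distance. The induction
is on the size of W and, for fixed W, on the number of points of W charged by
rho. *)
Lemma off_face_mass_le V (d : R) : uniq V -> 0 <= d ->
  (forall W x y, facial V W -> cone W 1 x -> cone [seq v <- V | v \notin W] 1 y ->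
     d <= enorm (x - y)) ->
  forall W x (rho : 'rV[R]_n -> R), facial V W -> (forall v, 0 <= rho v) ->
    cone W (\sum_(v <- V) rho v) x ->
    d * \sum_(v <- V | v \notin W) rho v <= enorm (x - \sum_(v <- V) rho v *: v).
Proof.
move=> uV d0 dP W.
have [N] := ubnP (size W); elim: N W => // N IHN W WN x rho fW.
have [k] := ubnP (count (fun v => 0 < rho v) W).
elim: k x rho => // k IHk x rho rk rho0 Wx.
have uW := facial_uniq uV fW; have subW := facial_sub fW.
have [/hasP[v vW rv]|/hasPn rW] := boolP (has (fun v => 0 < rho v) W); last first.
  set t := \sum_(v <- V | _) _.
  have off F : (forall v, v \in W -> F v = 0) ->
      \sum_(v <- V) F v = \sum_(v <- V | v \notin W) F v :> R.
    move=> F0; rewrite (bigID (mem W))/= big1 ?add0r//.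
  have rW0 v : v \in W -> rho v = 0.
    by move=> /rW; rewrite -leNgt => rv; apply/le_anti; rewrite rv rho0.
  have tE : \sum_(v <- V) rho v = t by exact: off.
  have yE : \sum_(v <- V) rho v *: v = \sum_(v <- V | v \notin W) rho v *: v.
    rewrite (bigID (mem W))/= big1 ?add0r// => v /rW0 ->; exact: scale0r.
  have t0 : 0 <= t by apply: sumr_ge0.
  have [->|tn0] := eqVneq t 0; first by rewrite mulr0 enorm_ge0.
  have tV0 : 0 <= t^-1 by rewrite invr_ge0.
  have Wx1 : cone W 1 (t^-1 *: x).
    by rewrite -(mulVf tn0); apply: coneZ => //; rewrite -tE.
  have Vy1 : cone [seq v <- V | v \notin W] 1 (t^-1 *: \sum_(v <- V) rho v *: v).
    rewrite -(mulVf tn0); apply: coneZ => //.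
    by exists rho; rewrite !big_filter.
  have := dP _ _ _ fW Wx1 Vy1; rewrite -scalerBr enormZ// => h.
  have := ler_wpM2r t0 h; rewrite mulrAC mulVf// mul1r; apply: le_trans.
  by [].
(* x can give up t units of v and no more *)
have [t [t0 Wt tmax]] := cone_max_removal v uW Wx.
have vV := subW _ vW.
pose rho' q u := rho u - (if u == v then q else 0).
have rho'0 q : q <= rho v -> forall u, 0 <= rho' q u.
  by move=> qv u; rewrite /rho'; case: eqP => [->|_]; rewrite ?subr0 ?subr_ge0.
have rho'm q : \sum_(u <- V) rho' q u = \sum_(u <- V) rho u - q.
  rewrite sumrB; congr (_ - _); rewrite (bigD1_seq v)//= eqxx big1 ?addr0// => u.
  by move/negPf ->.
have rho'b q : \sum_(u <- V) rho' q u *: u = \sum_(u <- V) rho u *: u - q *: v.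
  rewrite (eq_bigr (fun u => rho u *: u - (if u == v then q else 0) *: u)); last first.
    by move=> u _; rewrite scalerBl.
  rewrite sumrB; congr (_ - _); rewrite (bigD1_seq v)//= eqxx big1 ?addr0// => u.
  by move/negPf ->; rewrite scale0r.
have sameB q : x - q *: v - (\sum_(u <- V) rho' q u *: u) = x - \sum_(u <- V) rho u *: u.
  by rewrite rho'b opprB addrA subrK.
have [rt|tr] := leP (rho v) t.
  have <- : \sum_(u <- V | u \notin W) rho' (rho v) u = \sum_(u <- V | u \notin W) rho u.
    apply: eq_bigr => u; rewrite /rho'; case: eqP => [->|]; last by rewrite subr0.
    by rewrite vW.
  rewrite -(sameB (rho v)); apply: IHk; last first.
  - rewrite rho'm; have -> : x - rho v *: v = x - t *: v + (t - rho v) *: v.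
      by rewrite scalerBl addrA subrK.
    have -> : \sum_(u <- V) rho u - rho v =
        (\sum_(u <- V) rho u - t) + (t - rho v) * 1 by ring.
    by apply: coneD => //; apply: coneZ; rewrite ?subr_ge0//; apply: cone1.
  - exact: rho'0.
  - rewrite -ltnS; apply: leq_trans rk; rewrite ltnS.
    rewrite !(permP (perm_to_rem vW))/= {1}/rho' eqxx subrr ltxx rv add0n add1n ltnS.
    apply: sub_count => u; rewrite /rho'; case: eqP => [->|_]; last by rewrite subr0.
    by rewrite subrr ltxx.
(* rho keeps some of v, and the rest of x lies over a face of W without v *)
have [c [b [cb cv cx]]] := cone_boundary uW Wt tmax.
have := facial_trans fW cb; set W' := [seq _ <- _ | _] => fW'.
have vW' : v \notin W' by rewrite mem_filter lt_eqF.
have W'W : {subset W' <= W} by move=> u; rewrite mem_filter => /andP[].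
apply: (@le_trans _ _ (d * \sum_(u <- V | u \notin W') rho' t u)).
  rewrite ler_wpM2l//.
  have <- : \sum_(u <- V | u \notin W) rho' t u = \sum_(u <- V | u \notin W) rho u.
    apply: eq_bigr => u; rewrite /rho'; case: eqP => [->|]; last by rewrite subr0.
    by rewrite vW.
  rewrite big_mkcond [leRHS]big_mkcond; apply: ler_sum => u _.
  case: (boolP (u \in W)) => uW1 /=; case: ifP => // uW'.
    by rewrite rho'0// ltW.
  by move: uW1; rewrite W'W//; move/negbFE: uW'.
rewrite -(sameB t); apply: IHN => //.
- rewrite -ltnS; apply: leq_trans WN; rewrite ltnS size_filter.
  rewrite -(count_predC (fun u => dotv c u == b) W) -[ltnLHS]addn0 ltn_add2l -has_count.
  by apply/hasP; exists v; rewrite //= lt_eqF.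
- by apply: rho'0; exact: ltW.
- by rewrite rho'm; apply: cone_supp.
Qed.

End Cone.

(** * Convex hulls, vertices and pyramidal width *)

(* [conv] alone would denote the barycentre of two points of a convex space *)
Local Notation hull := Pilot.Defs.conv.

Section Polytope.
Variables (R : realType) (n : nat).
Implicit Types (A E P : set 'rV[R]_n) (s V W : seq 'rV[R]_n) (c x y v : 'rV[R]_n) (m b t : R).

Lemma conv_min A E :
  (forall x y t, 0 <= t -> t <= 1 -> E x -> E y -> E (t *: x + (1 - t) *: y)) ->
  A `<=` E -> hull A `<=` E.
Proof.
move=> cE AE; apply: smallest_sub => // x y l /set_mem Ex /set_mem Ey.
by apply/mem_set; apply: (cE x y l%:num).
Qed.

Lemma conv_convex A x y t : 0 <= t -> t <= 1 -> hull A x -> hull A y ->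
  hull A (t *: x + (1 - t) *: y).
Proof.
move=> t0 t1 Ax Ay E [cE AE].
have /set_mem := cE x y (Itv01 t0 t1) (mem_set (Ax E (conj cE AE))) (mem_set (Ay E (conj cE AE))).
exact.
Qed.

Lemma sub_conv A : A `<=` hull A.
Proof. exact: sub_gen_smallest. Qed.

Lemma cone0 s x : cone s 0 x -> x = 0.
Proof.
case=> w [w0 /eqP]; rewrite eq_sym psumr_eq0// => /allP ws ->.
by rewrite big_seq big1// => v /ws/eqP ->; rewrite scale0r.
Qed.

Lemma cone_const s m v x : {in s, forall u, u = v} -> cone s m x -> x = m *: v.
Proof.
move=> sv [w [_ -> ->]]; rewrite scaler_suml.
by apply: eq_big_seq => u /sv ->.
Qed.

Lemma cone_conv A s m x : {in s, forall v, A v} -> cone s m x -> 0 < m ->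
  hull A (m^-1 *: x).
Proof.
elim: s m x => [|v s IH] m x sA [w [w0 mE xE]].
  by rewrite mE big_nil ltxx.
move: mE xE; rewrite !big_cons; set m' := \sum_(_ <- _) _; set x' := \sum_(_ <- _) _.
have sx' : cone s m' x' by exists w.
move=> mE xE m0; have Av : hull A v by apply: sub_conv; apply: sA; exact: mem_head.
have := cone_ge0 sx'; rewrite le_eqVlt => /predU1P[m'0|m'0].
  move: mE xE sx'; rewrite -m'0 addr0 => mE xE /cone0 x'0.
  by rewrite xE x'0 addr0 scalerA -mE mulVf ?gt_eqF// scale1r.
have -> : m^-1 *: x = (w v / m) *: v + (1 - w v / m) *: (m'^-1 *: x').
  have -> : 1 - w v / m = m' / m.
    by rewrite -{1}(divff (lt0r_neq0 m0)) -mulrBl {1}mE addrC addKr.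
  rewrite xE scalerDr !scalerA mulrC; congr (_ + _ *: _).
  by rewrite mulrAC divff ?gt_eqF// mul1r.
apply: conv_convex => //; first by rewrite divr_ge0 ?w0 ?(ltW m0).
  by rewrite ler_pdivrMr// mul1r mE lerDl ltW.
by apply: IH => // u us; apply: sA; rewrite inE us orbT.
Qed.

Lemma conv_seq s x : uniq s -> hull [set` s] x <-> cone s 1 x.
Proof.
move=> us; split; last first.
  by move=> sx; rewrite -(scale1r x) -(invr1 R); apply: cone_conv sx _.
apply: conv_min => [{}x y t t0 t1 sx sy|v/=]; last exact: cone1.
have tE : t * 1 + (1 - t) * 1 = 1 by ring.
rewrite -[X in cone _ X _]tE.
by apply: coneD; apply: coneZ; rewrite ?subr_ge0.
Qed.

Lemma irredundant_generators s : uniq s -> exists s', [/\ uniq s',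
  hull [set` s'] = hull [set` s] & {in s', forall v, ~ cone (rem v s') 1 v}].
Proof.
have [N] := ubnP (size s); elim: N s => // N IH s sN us.
have [[v [vs sv]]|irr] := pselect (exists v, v \in s /\ cone (rem v s) 1 v); last first.
  by exists s; split=> // v vs sv; apply: irr; exists v.
have ur : uniq (rem v s) by rewrite rem_uniq.
have [||s' [us' s'E irr]] := IH (rem v s); rewrite ?ur//.
  by rewrite size_rem// -ltnS prednK// -has_predT; apply/hasP; exists v.
exists s'; split=> //; rewrite s'E; apply/seteqP; split.
  apply: conv_min => [*|u /= /mem_rem us0]; first exact: conv_convex.
  exact: sub_conv.
apply: conv_min => [*|u /= us0]; first exact: conv_convex.
have [->|uv] := eqVneq u v; first exact/conv_seq.
by apply: sub_conv; rewrite /= (rem_filter _ us) mem_filter /= uv.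
Qed.

(** In an irredundant generating set every point v is a vertex: Farkas' lemma
separates v strictly from the others, and the separating functional attains its
maximum over the hull at v only. Conversely, a vertex is a combination of
generators that lie in the face it forms, so it is one of them. *)
Lemma polytope_vertices P : polytope P ->
  exists V, [/\ uniq V, P = hull [set` V] & vertices P = [set` V]].
Proof.
case=> A /finite_seqP[s ->] ->.
have [V [uV VE irr]] := irredundant_generators (undup_uniq s).
have -> : [set` s] = [set` undup s].
  by apply/seteqP; split=> v /=; rewrite mem_undup.
rewrite -VE; exists V; split=> //.
  apply/seteqP; split=> v /=.
    move=> [c [b [cb vE]]].
    have [/(conv_seq _ uV) Vv cv] : (hull [set` V] `&` [set x | dotv c x = b]) v by rewrite -vE.
    have cbV : {in V, forall u, dotv c u <= b} by move=> u uV'; apply: cb; exact: sub_conv.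
    have := cone_supp cbV Vv; rewrite mulr1 => /(_ cv).
    case E : [seq _ <- _ | _] => [|u r] [w [_]].
      by rewrite big_nil => /eqP; rewrite oner_eq0.
    have : u \in [seq v <- V | dotv c v == b] by rewrite E mem_head.
    rewrite mem_filter => /andP[/eqP cu uV'] _ _.
    suff <- : u = v by [].
    have : (hull [set` V] `&` [set x | dotv c x = b]) u by split=> //; exact: sub_conv.
    by rewrite -vE.
  move=> vV; have [/(irr _ vV)//|[c [b [cb]]]] := cone_farkas 1 v (rem_uniq v uV).
  rewrite mulr1 => bv; have cV : {in V, forall u, dotv c u <= dotv c v}.
    move=> u uV'; have [->//|uv] := eqVneq u v.
    by rewrite (le_trans _ (ltW bv))// cb// (rem_filter _ uV) mem_filter /= uv.
  exists c, (dotv c v); split.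
    by move=> x /(conv_seq _ uV)/(cone_le cV); rewrite mulr1.
  apply/seteqP; split=> [_ -> /=|x [/(conv_seq _ uV) Vx /= cx]].
    by split=> //; exact: sub_conv.
  have := cone_supp cV Vx; rewrite mulr1 => /(_ cx) /(@cone_const _ _ v).
  rewrite scale1r; apply => u; rewrite mem_filter => /andP[/eqP cu uV'].
  apply/eqP/negPn/negP => uv; have := cb u.
  by rewrite (rem_filter _ uV) mem_filter /= uv cu leNgt bv => /(_ uV').
Qed.

Lemma inf_ge0 (E : set R) : (forall d, E d -> 0 <= d) -> 0 <= inf E.
Proof.
move=> E0; have [->|/set0P En] := eqVneq E set0; first by rewrite inf0.
exact: lb_le_inf.
Qed.

Lemma dist_ge0 A B : 0 <= @dist R n A B.
Proof. by apply: inf_ge0 => d [x [y [_ _ ->]]]; exact: enorm_ge0. Qed.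

Lemma dist_le A B x y : A x -> B y -> dist A B <= enorm (x - y).
Proof.
move=> Ax By; apply: ge_inf; last by exists x, y.
by exists 0 => d [u [v [_ _ ->]]]; exact: enorm_ge0.
Qed.

Lemma pyramidal_width_ge0 P : 0 <= pyramidal_width P.
Proof. by apply: inf_ge0 => d [f _ <-]; exact: dist_ge0. Qed.

Lemma pyramidal_width_le P f x y : proper_face P f -> f x ->
  hull (vertices P `\` f) y -> pyramidal_width P <= enorm (x - y).
Proof.
move=> Pf fx fy; apply: le_trans (dist_le fx fy); apply: ge_inf; last by exists f.
by exists 0 => d [g _ <-]; exact: dist_ge0.
Qed.

Lemma width_off_face_mass_le V c b x (rho : 'rV[R]_n -> R) :
  let P := hull [set` V] in
  uniq V -> vertices P = [set` V] ->
  {in V, forall v, dotv c v <= b} -> P x -> dotv c x = b ->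
  (forall v, 0 <= rho v) -> \sum_(v <- V) rho v = 1 ->
  pyramidal_width P * \sum_(v <- V | dotv c v != b) rho v <=
    enorm (x - \sum_(v <- V) rho v *: v).
Proof.
move=> P uV VP cb /(conv_seq _ uV) Vx cx rho0 rho1.
pose W := [seq v <- V | dotv c v == b].
have -> : \sum_(v <- V | dotv c v != b) rho v = \sum_(v <- V | v \notin W) rho v.
  rewrite big_seq_cond [RHS]big_seq_cond; apply: eq_bigl => v.
  by rewrite mem_filter; case: (v \in V); rewrite ?andbT.
apply: off_face_mass_le => //; first exact: pyramidal_width_ge0.
- move=> W' x1 y [c1 [b1 [cb1 ->]]] Wx Wy.
  set f := P `&` [set z | dotv c1 z = b1].
  have fP : face P f.
    exists c1, b1; split=> // z /(conv_seq _ uV)/(cone_le cb1); by rewrite mulr1.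
  have sub (p : pred 'rV[R]_n) m z : cone [seq v <- V | p v] m z -> cone V m z.
    move=> [w [w0 -> ->]]; exists (fun v => if p v then w v else 0); split.
    - by move=> v; case: ifP.
    - by rewrite big_filter big_mkcond.
    - rewrite big_filter big_mkcond; apply: eq_bigr => v _.
      by case: ifP => //; rewrite scale0r.
  apply: (@pyramidal_width_le _ f).
  + split=> //.
      apply/eqP/set0P; exists x1; split; first exact/conv_seq/sub/Wx.
      rewrite /= -[RHS]mulr1; apply: cone_level Wx => v.
    by rewrite mem_filter => /andP[/eqP].
    case: Wy => w; case E : [seq _ <- _ | _] => [|v r] [w0 w1 _].
      by move/eqP: w1; rewrite big_nil oner_eq0.
    move=> fE; have : v \in v :: r by rewrite mem_head.
    rewrite -E !mem_filter => /andP[nv vV]; have : P v by exact: sub_conv.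
    by rewrite -fE => -[_ /= /eqP cv]; rewrite cv vV in nv.
  + split; first exact/conv_seq/sub/Wx.
    rewrite /= -[RHS]mulr1; apply: cone_level Wx => v.
    by rewrite mem_filter => /andP[/eqP].
  + rewrite -(scale1r y) -(invr1 R); apply: cone_conv Wy _ => //.
    move=> v; rewrite !mem_filter => /andP[nv vV]; split; first by rewrite VP.
    by move=> [_ /= /eqP cv]; rewrite cv vV in nv.
- by exists c, b.
- by rewrite rho1; apply: cone_supp; rewrite ?mulr1.
Qed.

End Polytope.

(** * Faces and vertices of a product *)

Section Product.
Variables (R : realType) (n k : nat).
Implicit Types (P : 'I_k -> set 'rV[R]_n) (c x y : 'rV[R]_(k * n)) (p : 'I_k -> 'rV[R]_n).

Definition coord (i : 'I_k) x : 'rV[R]_n := row i (vec_mx x).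

Definition glue p : 'rV[R]_(k * n) := mxvec (\matrix_i p i).

Lemma coord_glue p i : coord i (glue p) = p i.
Proof. by rewrite /coord mxvecK rowK. Qed.

Lemma glue_coord x : glue (coord^~ x) = x.
Proof.
rewrite /glue (_ : \matrix_i _ = vec_mx x) ?vec_mxK//.
by apply/row_matrixP => i; rewrite rowK.
Qed.

Lemma coordD i x y : coord i (x + y) = coord i x + coord i y.
Proof. by rewrite /coord !linearD. Qed.

Lemma coordZ i (a : R) x : coord i (a *: x) = a *: coord i x.
Proof. by rewrite /coord !linearZ. Qed.

Lemma coordB i x y : coord i (x - y) = coord i x - coord i y.
Proof. by rewrite /coord !linearB. Qed.

Lemma dotv_coord c x : dotv c x = \sum_i dotv (coord i c) (coord i x).
Proof.
rewrite /dotv pair_bigA (reindex _ (curry_mxvec_bij _ _)) /=.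
by apply: eq_bigr => -[i j] _; rewrite !mxE.
Qed.

Lemma sqr_enorm m (x : 'rV[R]_m) : enorm x ^+ 2 = dotv x x.
Proof. by rewrite sqr_sqrtr// sumr_ge0// => j _; rewrite sqr_ge0. Qed.

Lemma sqr_enorm_coord x : enorm x ^+ 2 = \sum_i enorm (coord i x) ^+ 2.
Proof. by rewrite sqr_enorm dotv_coord; apply: eq_bigr => i _; rewrite sqr_enorm. Qed.

(** Replacing the component i of x by z gives another point of the product. *)
Lemma coord_maximizes P c b x : (forall y, cart_prod P y -> dotv c y <= b) ->
  cart_prod P x -> dotv c x = b ->
  forall i z, P i z -> dotv (coord i c) z <= dotv (coord i c) (coord i x).
Proof.
move=> cb Px cx i z Pz; pose p j := if j == i then z else coord j x.
have := cb (glue p); rewrite -cx !dotv_coord (bigD1 i)//= [leRHS](bigD1 i)//=.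
rewrite (eq_bigr (fun j => dotv (coord j c) (coord j x))); last first.
  by move=> j /negPf ji; rewrite coord_glue /p ji.
rewrite coord_glue /p eqxx lerD2r; apply => j; rewrite -/(coord j _) coord_glue.
by rewrite /p; case: eqP => [->|_] //; exact: Px.
Qed.

Lemma sum_tight (f g : 'I_k -> R) : (forall i, f i <= g i) ->
  \sum_i f i = \sum_i g i -> forall i, f i = g i.
Proof.
move=> fg /eqP; rewrite eq_sym -subr_eq0 -sumrB psumr_eq0; last first.
  by move=> i _; rewrite subr_ge0.
by move=> /allP h i; have := h i (mem_index_enum _); rewrite subr_eq0 => /eqP.
Qed.

Lemma vertex_coord P x i : vertices (cart_prod P) x -> vertices (P i) (coord i x).
Proof.
move=> [c [b [cb xE]]].
have [Px cx] : (cart_prod P `&` [set y | dotv c y = b]) x by rewrite -xE.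
have cmax := coord_maximizes cb Px cx.
exists (coord i c), (dotv (coord i c) (coord i x)); split; first exact: cmax.
apply/seteqP; split=> [_ -> /=|z [Pz /= cz]]; first by split=> //; exact: Px.
pose p j := if j == i then z else coord j x.
have : (cart_prod P `&` [set y | dotv c y = b]) (glue p).
  split.
    move=> j; rewrite -/(coord j _) coord_glue /p; case: eqP => [->|_] //; exact: Px.
  rewrite /= -cx !dotv_coord; apply: eq_bigr => j _.
  by rewrite coord_glue /p; case: eqP => [->|].
rewrite -xE => /= <-; by rewrite coord_glue /p eqxx.
Qed.

Lemma glue_vertices P p : (forall i, vertices (P i) (p i)) ->
  vertices (cart_prod P) (glue p).
Proof.
move=> Pp.
have /choice[cb cbP] : forall i, exists cb : 'rV[R]_n * R,
    (forall z : 'rV[R]_n, P i z -> dotv cb.1 z <= cb.2) /\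
    [set p i] = P i `&` [set z | dotv cb.1 z = cb.2].
  by move=> i; have [c [b ?]] := Pp i; exists (c, b).
have cE x : dotv (glue (fun i => (cb i).1)) x = \sum_i dotv (cb i).1 (coord i x).
  by rewrite dotv_coord; apply: eq_bigr => i _; rewrite coord_glue.
have [Ppi cpi] : (forall i, P i (p i)) /\ forall i, dotv (cb i).1 (p i) = (cb i).2.
  by split=> i; have [_ /seteqP[/(_ _ erefl)[]]] := cbP i.
exists (glue (fun i => (cb i).1)), (\sum_i (cb i).2); split.
  by move=> x Px; rewrite cE; apply: ler_sum => i _; apply: (cbP i).1; exact: Px.
apply/seteqP; split=> [_ -> /=|x [Px /=]].
  split=> [i|/=]; first by rewrite -/(coord i _) coord_glue.
  by rewrite cE; apply: eq_bigr => i _; rewrite coord_glue.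
rewrite cE => /sum_tight cx; rewrite -[LHS]glue_coord; congr glue; apply: funext => i.
suff : [set p i] (coord i x) by [].
rewrite (cbP i).2; split; first exact: Px.
by apply: cx => j; apply: (cbP j).1; exact: Px.
Qed.

Lemma sum_sqr_ge (mu : 'I_k -> R) : 1 <= \sum_i mu i ->
  1 <= k%:R * \sum_i mu i ^+ 2.
Proof.
move=> mu1; have [k0|k0] := posnP k.
  by move: mu1; rewrite big1 ?ler10// => i; have := ltn_ord i; rewrite {2}k0.
have kR : 0 < k%:R :> R by rewrite ltr0n.
(* expand the sum of squares of k mu_i - 1 *)
have : 0 <= \sum_i (k%:R * mu i - 1) ^+ 2 by apply: sumr_ge0 => i _; exact: sqr_ge0.
rewrite (eq_bigr (fun i => k%:R ^+ 2 * mu i ^+ 2 + (- (2 * k%:R) * mu i + 1))); last first.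
  by move=> i _; ring.
rewrite !big_split /= -!mulr_sumr sumr_const card_ord => h.
have h' : 0 <= k%:R * (k%:R * \sum_i mu i ^+ 2 - 2 * \sum_i mu i + 1).
  by apply: le_trans h _; rewrite le_eqVlt; apply/orP; left; apply/eqP; ring.
rewrite pmulr_rge0// in h'; lra.
Qed.

(** The set Q below describes y through its marginals: convex combinations rho_i
of the vertices of the factors whose masses off the faces of the factors
add up to at least 1. Q is convex and contains the vertices off the face, hence
their hull. *)
Lemma cart_prod_face_gap (V : 'I_k -> seq 'rV[R]_n) (d : R) c b x y :
  let P i := hull [set` V i] in
  (forall i, uniq (V i)) -> (forall i, vertices (P i) = [set` V i]) ->
  0 <= d -> (forall i, d <= pyramidal_width (P i)) ->
  (forall z, cart_prod P z -> dotv c z <= b) ->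
  cart_prod P x -> dotv c x = b ->
  hull (vertices (cart_prod P) `\` (cart_prod P `&` [set z | dotv c z = b])) y ->
  d ^+ 2 <= k%:R * enorm (x - y) ^+ 2.
Proof.
move=> P uV VP d0 dP cb Px cx Py.
pose off i v := dotv (coord i c) v != dotv (coord i c) (coord i x).
pose Q : set 'rV[R]_(k * n) := [set z | exists rho : 'I_k -> 'rV[R]_n -> R,
  [/\ forall i v, 0 <= rho i v, forall i, \sum_(v <- V i) rho i v = 1,
    forall i, coord i z = \sum_(v <- V i) rho i v *: v &
    1 <= \sum_i \sum_(v <- V i | off i v) rho i v]].
have : Q y.
  move: y Py; apply: conv_min => [y1 y2 t t0 t1|v [Vv fv]].
    move=> [r1 [r10 r11 r1y r1m]] [r2 [r20 r21 r2y r2m]].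
    have t1' : 0 <= 1 - t by rewrite subr_ge0.
    exists (fun i v => t * r1 i v + (1 - t) * r2 i v); split.
    - by move=> i v; rewrite addr_ge0// mulr_ge0.
    - by move=> i; rewrite big_split/= -!mulr_sumr r11 r21; ring.
    - move=> i; rewrite coordD !coordZ r1y r2y !scaler_sumr -big_split.
      by apply: eq_bigr => v _; rewrite !scalerA scalerDl.
    - under eq_bigr do rewrite big_split/= -!mulr_sumr.
      rewrite big_split/= -!mulr_sumr; nra.
  have Vi i : coord i v \in V i by have := vertex_coord i Vv; rewrite VP.
  have Pv : cart_prod P v by move=> i; apply: sub_conv; exact: Vi.
  have [[i ci]|tight] := pselect (exists i, off i (coord i v)); last first.
    case: fv; split=> //=; rewrite -cx !dotv_coord; apply: eq_bigr => i _.
    by apply/eqP/negPn/negP => ci; apply: tight; exists i.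
  exists (fun j u => (u == coord j v)%:R); split.
  - by move=> j u; rewrite ler0n.
  - by move=> j; rewrite (bigD1_seq (coord j v))//= eqxx big1 ?addr0// => u /negPf ->.
  - move=> j; rewrite (bigD1_seq (coord j v))//= eqxx scale1r big1 ?addr0// => u /negPf ->.
    by rewrite scale0r.
  - rewrite (bigD1 i)//= -[leLHS]addr0 lerD//.
      rewrite big_mkcond (bigD1_seq (coord i v))//= ci eqxx lerDl sumr_ge0// => u _.
      by case: ifP.
    by apply: sumr_ge0 => j _; apply: sumr_ge0.
move=> [rho [rho0 rho1 yE mu1]].
have le1 i : d * (\sum_(v <- V i | off i v) rho i v) <= enorm (coord i (x - y)).
  have cV : {in V i, forall v, dotv (coord i c) v <= dotv (coord i c) (coord i x)}.
    by move=> v vV; apply: (coord_maximizes cb Px cx); exact: sub_conv.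
  have := width_off_face_mass_le (uV i) (VP i) cV (Px i) erefl (rho0 i) (rho1 i).
  by rewrite coordB yE; apply: le_trans; rewrite ler_wpM2r ?dP// sumr_ge0.
apply: (@le_trans _ _ (k%:R * \sum_i (d * \sum_(v <- V i | off i v) rho i v) ^+ 2)).
  under eq_bigr do rewrite exprMn.
  by rewrite -mulr_sumr mulrCA ler_peMr ?sqr_ge0// sum_sqr_ge.
rewrite sqr_enorm_coord ler_wpM2l// ler_sum// => i _.
by rewrite ler_sqr ?nnegrE ?le1// ?enorm_ge0// mulr_ge0// sumr_ge0.
Qed.

(** Some component has a vertex v off the face of its factor, as otherwise the
face would be the whole product; complete v by arbitrary vertices of the other
factors. This makes the second set in the pyramidal width nonempty, so that its
distance from the face is not the default value 0 of an infimum. *)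
Lemma vertex_off_face (V : 'I_k -> seq 'rV[R]_n) c b x :
  let P i := hull [set` V i] in
  (forall i, uniq (V i)) -> (forall i, vertices (P i) = [set` V i]) ->
  (forall z, cart_prod P z -> dotv c z <= b) ->
  cart_prod P x -> dotv c x = b ->
  cart_prod P `&` [set z | dotv c z = b] <> cart_prod P ->
  exists v, vertices (cart_prod P) v /\ dotv c v <> b.
Proof.
move=> P uV VP cb Px cx fP.
have V0 i : exists v, v \in V i.
  have := Px i => /(conv_seq _ (uV i))[w [_]]; case: (V i) => [|v r].
    by rewrite big_nil => /eqP; rewrite oner_eq0.
  by move=> _ _; exists v; rewrite mem_head.
have cmax := coord_maximizes cb Px cx.
have [[i [v [vV cv]]]|tight] := pselect (exists i v,
    v \in V i /\ dotv (coord i c) v <> dotv (coord i c) (coord i x)).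
  have /choice[p pV] := V0.
  pose q j := if j == i then v else p j.
  have qV j : q j \in V j by rewrite /q; case: eqP => [->|].
  exists (glue q); split; first by apply: glue_vertices => j; rewrite VP; exact: qV.
  rewrite -cx !dotv_coord => /sum_tight cq; apply: cv; rewrite -[RHS]cq.
    by rewrite coord_glue /q eqxx.
  by move=> j; rewrite coord_glue; apply: cmax; apply: sub_conv; exact: qV.
case: fP; apply/seteqP; split=> [z []//|z Pz]; split=> //=.
rewrite -cx !dotv_coord; apply: eq_bigr => i _.
have [w [w0 w1 zE]] : cone (V i) 1 (coord i z) 
  by apply/conv_seq; [exact: uV | exact: Pz].
rewrite zE dotv_sumr -[RHS]mul1r w1 mulr_suml; apply: eq_big_seq => v vV.
by congr (_ * _); apply: contrapT => cv; apply: tight; exists i, v.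
Qed.

End Product.

(** * The width of a product *)

Lemma pyramidal_width_cart_prod_ge (R : realType) n k (P : 'I_k -> set 'rV[R]_n) (d : R) :
  (0 < k)%N -> (forall i, polytope (P i)) -> (forall i, at_least_two_vertices (P i)) ->
  0 <= d -> (forall i, d <= pyramidal_width (P i)) ->
  d <= Num.sqrt k%:R * pyramidal_width (cart_prod P).
Proof.
move=> k0 Ppol P2 d0 dP.
have /choice[V VP] : forall i, exists V, [/\ uniq V, P i = hull [set` V] &
   vertices (P i) = [set` V]] by move=> i; exact: polytope_vertices.
have PE : P = fun i => hull [set` V i] by apply: funext => i; have [] := VP i.
have uV i : uniq (V i) by have [] := VP i.
have VE i : vertices (hull [set` V i]) = [set` V i] by have [_ <-] := VP i.
clear VP; subst P; set P := fun i => hull [set` V i].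
have sk : 0 < Num.sqrt k%:R :> R by rewrite sqrtr_gt0 ltr0n.
rewrite mulrC -ler_pdivrMr//; apply: lb_le_inf.
  (* a vertex u is a proper face, as v is another vertex *)
  have /choice[uv uvP] : forall i, exists uv : 'rV[R]_n * 'rV[R]_n,
      [/\ vertices (P i) uv.1, vertices (P i) uv.2 & uv.1 <> uv.2].
    by move=> i; have [u [v uv]] := P2 i; exists (u, v).
  pose u := glue (fun i => (uv i).1); pose v := glue (fun i => (uv i).2).
  have Pu : vertices (cart_prod P) u by apply: glue_vertices => i; have [] := uvP i.
  have Pv : vertices (cart_prod P) v by apply: glue_vertices => i; have [] := uvP i.
  exists (dist [set u] (hull (vertices (cart_prod P) `\` [set u]))), [set u] => //.
  split=> //; first by apply/eqP/set0P; exists u.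
  move=> uE; have : cart_prod P v by have [c [b [_ /seteqP[/(_ _ erefl)[]]]]] := Pv.
  rewrite -uE /= => vu; have [_ _] := uvP (Ordinal k0); apply.
  by have := congr1 (coord (Ordinal k0)) vu; rewrite !coord_glue.
move=> _ [f [[c [b [cb fE]]] f0 fP] <-]; subst f.
have [x [Px cx]] : cart_prod P `&` [set z | dotv c z = b] !=set0 by apply/set0P/eqP.
apply: lb_le_inf.
  have [v [Vv cv]] := vertex_off_face uV VE cb Px cx fP.
  by exists (enorm (x - v)), x, v; split=> //; apply: sub_conv; split=> // -[].
move=> _ [{}x [y [[{}Px {}cx] fy ->]]]; rewrite ler_pdivrMr//.
have h := cart_prod_face_gap uV VE d0 dP cb Px cx fy.
rewrite -ler_sqr ?nnegrE ?mulr_ge0 ?enorm_ge0 ?sqrtr_ge0//.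
by rewrite exprMn mulrC sqr_sqrtr ?ler0n.
Qed.

(* [up_log 2 m] is the ceiling of the base-2 logarithm of [m]; the infimum over
   the nonempty finite family of widths is its minimum. *)
Theorem corollaryA3 (R : realType) :
  exists2 c : R, 0 < c &
  forall (n k : nat) (P : 'I_k -> set 'rV[R]_n),
    (2 <= k)%N ->
    (forall i, polytope (P i)) ->
    (forall i, at_least_two_vertices (P i)) ->
    let min_delta := inf (range (fun i => pyramidal_width (P i))) in
    let bound := 1 / Num.sqrt 2 ^+ up_log 2 k.+1 * min_delta in
    bound <= pyramidal_width (cart_prod P) /\
    c / Num.sqrt k%:R * min_delta <= bound.
Proof.
exists (1 / 2) => [|n k P k2 Ppol P2]; first by rewrite divr_gt0.
set d := inf _; set u := up_log 2 k.+1; move=> bound.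
have d0 : 0 <= d by apply: inf_ge0 => _ [i _ <-]; exact: pyramidal_width_ge0.
have dP i : d <= pyramidal_width (P i).
  apply: ge_inf; last by exists i.
  by exists 0 => _ [j _ <-]; exact: pyramidal_width_ge0.
have k0 : (0 < k)%N by exact: ltnW.
have uE : Num.sqrt 2 ^+ u = Num.sqrt (2 ^ u)%:R :> R.
  rewrite -[LHS]ger0_norm ?exprn_ge0 ?sqrtr_ge0// -sqrtr_sqr.
  by rewrite -exprM mulnC exprM sqr_sqrtr ?ler0n// natrX.
have su : 0 < Num.sqrt (2 ^ u)%:R :> R by rewrite sqrtr_gt0 ltr0n expn_gt0.
have sk : 0 < Num.sqrt k%:R :> R by rewrite sqrtr_gt0 ltr0n.
have ku : (k <= 2 ^ u)%N by apply: ltnW; exact: up_logP.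
have uk : (2 ^ u <= 4 * k)%N.
  have := @up_log_gtn 2 k.+1 isT k0; rewrite -/u ltnS.
  have : (0 < u)%N by rewrite up_log_gt0.
  by case: u {uE su ku bound} => //= v _; rewrite expnS; lia.
rewrite /bound uE; split; last first.
  rewrite ler_wpM2r// ler_pdivrMr// mulrAC ler_pdivlMr// !mul1r.
  rewrite ler_pdivrMl// -ler_sqr ?nnegrE ?mulr_ge0 ?sqrtr_ge0//.
  by rewrite exprMn !sqr_sqrtr ?ler0n// -natrX -natrM ler_nat.
have := pyramidal_width_cart_prod_ge k0 Ppol P2 d0 dP.
rewrite mulrAC mul1r ler_pdivrMr// => /le_trans; apply.
by rewrite mulrC ler_wpM2l ?pyramidal_width_ge0// ler_wsqrtr// ler_nat.
Qed.
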